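(* The local-global divisibility by powers of $2$ can fail for torsion points of elliptic curves: there exist a number field $k$, an elliptic curve $\mathcal{E}$ defined over $k$, an integer $n \geq 1$ and a torsion point $P \in \mathcal{E}(k)$ such that for all but finitely many valuations $v$ of $k$ there exists $D_v \in \mathcal{E}(k_v)$ with $P = 2^n D_v$, but there is no $D \in \mathcal{E}(k)$ with $P = 2^n D$.
   Context: For a valuation $v$ of $k$, $k_v$ denotes the completion of $k$ at $v$. *)

(* Defs.v *)
From HB Require Import structures.
From mathcomp Require Import all_boot all_order all_algebra all_field.
From mathcomp Require Import all_classical all_reals all_analysis.
From mathcomp Require Import generic_quotient ring_quotient ring.

Set Implicit Arguments.
Unset Strict Implicit.
Unset Printing Implicit Defensive.

Import Order.TTheory GRing.Theory Num.Theory.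
Local Open Scope ring_scope.
Local Open Scope quotient_scope.

(** * Valuations *)

(* Valuations are multiplicative and real-valued, that is, nontrivial absolute
   values; both archimedean and ultrametric ones are included. *)
Record valuation (R : realType) (k : fieldType) := Valuation {
  vabs :> k -> R;
  vabs_ge0 : forall x, 0 <= vabs x;
  vabs_eq0 : forall x, (vabs x == 0) = (x == 0);
  vabsM : forall x y, vabs (x * y) = vabs x * vabs y;
  vabsD : forall x y, vabs (x + y) <= vabs x + vabs y;
  vabs_nontrivial : exists2 x, x != 0 & vabs x != 1 }.

Definition veq (R : realType) (k : fieldType) (v w : valuation R k) : Prop :=
  exists2 s : R, 0 < s & forall x, w x = v x `^ s.

(* Valuations are counted up to equivalence: the exceptional ones are those
   equivalent to a member of a finite family. *)
Definition for_almost_all_valuations (R : realType) (k : fieldType)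
    (Q : valuation R k -> Prop) : Prop :=
  exists (N : nat) (w : 'I_N -> valuation R k),
    forall v : valuation R k, (forall i, ~ veq (w i) v) -> Q v.

(** * Completion of a field at a valuation *)

Section Completion.
Variables (R : realType) (k : fieldType) (v : valuation R k).
Implicit Types (u w : nat -> k) (x y : k).

Lemma vabs0 : v 0 = 0.
Proof. by apply/eqP; rewrite vabs_eq0. Qed.

Lemma vabs1 : v 1 = 1.
Proof.
have v1 : v 1 != 0 by rewrite vabs_eq0 oner_eq0.
by apply: (mulfI v1); rewrite -vabsM !mulr1.
Qed.

Lemma vabsN x : v (- x) = v x.
Proof.
apply/eqP; rewrite -(@eqrXn2 _ 2) ?vabs_ge0 //.
by rewrite !expr2 -!vabsM mulrNN.
Qed.

Lemma vabsV x : v x^-1 = (v x)^-1.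
Proof.
have [->|x0] := eqVneq x 0; first by rewrite invr0 vabs0 invr0.
have vx0 : v x != 0 by rewrite vabs_eq0.
by apply: (mulfI vx0); rewrite -vabsM !divff ?vabs1.
Qed.

Lemma vabsB x y : v (x - y) <= v x + v y.
Proof. by rewrite -(vabsN y) vabsD. Qed.

Definition is_cauchy u : Prop := forall e : R, 0 < e ->
  exists N, forall m n, (N <= m)%N -> (N <= n)%N -> v (u m - u n) < e.

Definition is_null u : Prop := forall e : R, 0 < e ->
  exists N, forall n, (N <= n)%N -> v (u n) < e.

Definition cauchy_seqs : {pred nat -> k} := fun u => `[< is_cauchy u >].

Lemma cauchy_bounded u : is_cauchy u -> exists2 B : R, 0 < B & forall n, v (u n) <= B.
Proof.
move=> /(_ 1 ltr01)[N uN].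
exists (1 + \sum_(i < N.+1) v (u i)).
  by rewrite ltr_pwDl// sumr_ge0// => i _; exact: vabs_ge0.
move=> n; have [nN|Nn] := ltnP n N.+1.
  rewrite (bigD1 (Ordinal nN)) //= addrCA lerDl.
  by rewrite addr_ge0// sumr_ge0// => i _; exact: vabs_ge0.
rewrite (bigD1 ord_max) //= addrA -[leLHS]addr0 lerD//; last first.
  by rewrite sumr_ge0// => i _; exact: vabs_ge0.
rewrite -[u n](subrK (u N)) (le_trans (vabsD _ _ _))// lerD2r ltW// uN//.
exact: ltnW.
Qed.

Fact cauchy_seqs_subring : subring_closed cauchy_seqs.
Proof.
split=> [|u w /asboolP cu /asboolP cw|u w /asboolP cu /asboolP cw];
  apply/asboolP => e e0.
- by exists 0%N => m n _ _; rewrite subrr vabs0.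
- have e2 : 0 < e / 2 by rewrite divr_gt0.
  have [[M uM] [N wN]] := (cu _ e2, cw _ e2).
  exists (maxn M N) => m n; rewrite !geq_max => /andP[Mm Nm] /andP[Mn Nn].
  have -> : (u - w) m - (u - w) n = (u m - u n) - (w m - w n).
    by rewrite -[(u - w) m]/(u m - w m) -[(u - w) n]/(u n - w n); ring.
  by rewrite (le_lt_trans (vabsB _ _)) // (splitr e) ltrD ?uM ?wN.
- have [A A0 uA] := cauchy_bounded cu.
  have [B B0 wB] := cauchy_bounded cw.
  have eA : 0 < e / 2 / A by rewrite !divr_gt0.
  have eB : 0 < e / 2 / B by rewrite !divr_gt0.
  have [[M uM] [N wN]] := (cu _ eB, cw _ eA).
  exists (maxn M N) => m n; rewrite !geq_max => /andP[Mm Nm] /andP[Mn Nn].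
  have -> : (u * w) m - (u * w) n = (u m - u n) * w m + u n * (w m - w n).
    by rewrite -[(u * w) m]/(u m * w m) -[(u * w) n]/(u n * w n); ring.
  rewrite (le_lt_trans (vabsD _ _ _)) // (splitr e) !vabsM ltr_leD //.
    rewrite -[ltRHS](divfK (lt0r_neq0 B0)).
    by rewrite (@le_lt_trans _ _ (v (u m - u n) * B)) ?ler_wpM2l ?vabs_ge0// ltr_pM2r ?uM.
  rewrite -[leRHS](divfK (lt0r_neq0 A0)) mulrC.
  by rewrite ler_pM ?vabs_ge0 // ltW ?wN.
Qed.

HB.instance Definition _ := GRing.isSubringClosed.Build (nat -> k) cauchy_seqs cauchy_seqs_subring.

Record cauchy_seq := CauchySeq { cseq :> nat -> k; cseqP : cseq \in cauchy_seqs }.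

HB.instance Definition _ := [isSub for cseq].
HB.instance Definition _ := [Choice of cauchy_seq by <:].
HB.instance Definition _ := [SubChoice_isSubComNzRing of cauchy_seq by <:].

Implicit Types f g : cauchy_seq.

Definition null_seqs : {pred cauchy_seq} := fun f => `[< is_null f >].

Fact null_ideal : idealr_closed null_seqs.
Proof.
split=> [||a u w /asboolP nu /asboolP nw].
- by apply/asboolP => e e0; exists 0%N => n _; rewrite vabs0.
- apply/asboolP => /(_ 1 ltr01)[N /(_ N (leqnn N))].
  by rewrite vabs1 ltxx.
- have [A A0 aA] := cauchy_bounded (asboolW (cseqP a)).
  apply/asboolP => e e0.
  have e2 : 0 < e / 2 by rewrite divr_gt0.
  have eA : 0 < e / 2 / A by rewrite divr_gt0.
  have [[M uM] [N wN]] := (nu _ eA, nw _ e2).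
  exists (maxn M N) => n; rewrite geq_max => /andP[Mn Nn].
  rewrite -[cseq _ n]/(a n * u n + w n).
  rewrite (le_lt_trans (vabsD _ _ _)) // (splitr e) ler_ltD ?wN //.
  rewrite vabsM -[leRHS](divfK (lt0r_neq0 A0)) mulrC.
  by rewrite ler_pM ?vabs_ge0 // ltW ?uM.
Qed.

HB.instance Definition _ := isIdealr.Build cauchy_seq null_seqs null_ideal.

Definition completion := {ideal_quot null_seqs}.

HB.instance Definition _ := GRing.ComNzRing.on completion.

Definition class_of f : completion := \pi_({ideal_quot null_seqs}) f.

Lemma class_of_surj (q : completion) : exists f, q = class_of f.
Proof. by exists (repr q); rewrite /class_of reprK. Qed.

Lemma eq_class_of f g :
  (class_of f = class_of g) <-> is_null (fun n => f n - g n).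
Proof.
apply: (iff_trans (rwP eqP)); rewrite -Quotient.idealrBE.
by split=> [/asboolP|?]; last exact/asboolP.
Qed.

Fact class_of_is_zmod_morphism : zmod_morphism class_of.
Proof. by move=> f g; rewrite /class_of !piE. Qed.

Fact class_of_is_monoid_morphism : monoid_morphism class_of.
Proof. by split=> [|f g]; rewrite /class_of !piE. Qed.

HB.instance Definition _ := GRing.isZmodMorphism.Build
  cauchy_seq completion class_of class_of_is_zmod_morphism.
HB.instance Definition _ := GRing.isMonoidMorphism.Build
  cauchy_seq completion class_of class_of_is_monoid_morphism.

Lemma cauchy_away_from0 u : is_cauchy u -> ~ is_null u ->
  exists e : R, 0 < e /\ exists N, forall n, (N <= n)%N -> e <= v (u n).
Proof.
move=> cu nu; apply: contrapT => h; apply: nu => e e0.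
have e2 : 0 < e / 2 by rewrite divr_gt0.
have [N uN] := cu _ e2; exists N => n Nn.
rewrite ltNge; apply/negP => en; apply: h; exists (e / 2); split => //.
exists N => m Nm; have := vabsD v (u m) (u n - u m).
rewrite addrC subrK => /(le_trans en) /le_trans/(_ (lerD (lexx _) (ltW (uN _ _ Nn Nm)))).
by rewrite {1}(splitr e) lerD2r.
Qed.

Lemma cauchyV u : is_cauchy u -> ~ is_null u -> is_cauchy (fun n => (u n)^-1).
Proof.
move=> cu /(cauchy_away_from0 cu)[d [d0 [M uM]]] e e0.
have ed : 0 < e * (d * d) by rewrite !mulr_gt0.
have [N uN] := cu _ ed; exists (maxn M N) => m n.
rewrite !geq_max => /andP[Mm Nm] /andP[Mn Nn].
have [dm dn] := (uM _ Mm, uM _ Mn).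
have um : u m != 0 by rewrite -(vabs_eq0 v) lt0r_neq0 // (lt_le_trans d0).
have un : u n != 0 by rewrite -(vabs_eq0 v) lt0r_neq0 // (lt_le_trans d0).
have -> : (u m)^-1 - (u n)^-1 = (u n - u m) / (u m * u n).
  by field; rewrite um un.
rewrite vabsM vabsV vabsM ltr_pdivrMr ?mulr_gt0 ?(lt_le_trans d0) //.
by rewrite (lt_le_trans (uN _ _ Nn Nm)) // ler_pM2l // ler_pM // ltW.
Qed.

Lemma completion_inv (q : completion) : q != 0 -> exists r : completion, r * q = 1.
Proof.
have [u ->] := class_of_surj q; move=> u0.
have nu : ~ is_null u.
  move=> nu; move/eqP: u0; apply; rewrite -(rmorph0 class_of) eq_class_of.
  by move=> e /nu[N uN]; exists N => n /uN; rewrite -[cseq 0 n]/0 subr0.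
have cu : is_cauchy u := asboolW (cseqP u).
pose w := CauchySeq (asboolT (cauchyV cu nu)).
exists (class_of w); rewrite -rmorphM -(rmorph1 class_of) eq_class_of => e e0.
have [d [d0 [N uN]]] := cauchy_away_from0 cu nu.
exists N => n Nn; rewrite -[cseq _ n - _]/((u n)^-1 * u n - 1).
rewrite mulVf ?subrr ?vabs0 //.
by rewrite -(vabs_eq0 v) lt0r_neq0 // (lt_le_trans d0) ?uN.
Qed.

Definition inv_completion (q : completion) : completion :=
  if pselect (exists r, r * q = 1) is left h then projT1 (cid h) else 0.

Fact mulVcompletion (q : completion) : q != 0 -> inv_completion q * q = 1.
Proof.
rewrite /inv_completion => q0; case: pselect => [h|]; first by case: cid.
by move=> []; exact: completion_inv.
Qed.

Fact inv_completion0 : inv_completion 0 = 0.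
Proof.
rewrite /inv_completion; case: pselect => // h; have [r /eqP] := h.
by rewrite mulr0 eq_sym oner_eq0.
Qed.

HB.instance Definition _ :=
  GRing.ComNzRing_isField.Build completion mulVcompletion inv_completion0.

Fact const_cauchy x : (fun=> x) \in cauchy_seqs.
Proof. by apply/asboolP => e e0; exists 0%N => m n _ _; rewrite subrr vabs0. Qed.

Definition to_completion x : completion := class_of (CauchySeq (const_cauchy x)).

Fact to_completion_is_zmod_morphism : zmod_morphism to_completion.
Proof.
by move=> x y; rewrite /to_completion -rmorphB; congr class_of; exact/val_inj.
Qed.

Fact to_completion_is_monoid_morphism : monoid_morphism to_completion.
Proof.
split=> [|x y]; rewrite /to_completion -?rmorphM -?(rmorph1 class_of);
  by congr class_of; exact/val_inj.
Qed.

HB.instance Definition _ := GRing.isZmodMorphism.Build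
  k completion to_completion to_completion_is_zmod_morphism.
HB.instance Definition _ := GRing.isMonoidMorphism.Build
  k completion to_completion to_completion_is_monoid_morphism.

End Completion.

(** * Elliptic curves *)

(* The Weierstrass equation y^2 + a1 xy + a3 y = x^3 + a2 x^2 + a4 x + a6. *)
Record weierstrass (K : fieldType) :=
  Weierstrass { a1 : K; a2 : K; a3 : K; a4 : K; a6 : K }.

Inductive ec_point (K : fieldType) := Infinity | Affine of K & K.
Arguments Infinity {K}.

Section GroupLaw.
Variables (K : fieldType) (E : weierstrass K).
Local Notation a1 := (a1 E).
Local Notation a2 := (a2 E).
Local Notation a3 := (a3 E).
Local Notation a4 := (a4 E).
Local Notation a6 := (a6 E).

Definition discriminant : K :=
  let b2 := a1 ^+ 2 + 4%:R * a2 in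
  let b4 := 2%:R * a4 + a1 * a3 in
  let b6 := a3 ^+ 2 + 4%:R * a6 in
  let b8 := a1 ^+ 2 * a6 + 4%:R * a2 * a6 - a1 * a3 * a4 + a2 * a3 ^+ 2
            - a4 ^+ 2 in
  - b2 ^+ 2 * b8 - 8%:R * b4 ^+ 3 - 27%:R * b6 ^+ 2 + 9%:R * b2 * b4 * b6.

Definition is_elliptic : Prop := discriminant != 0.

Definition rational_points : {pred ec_point K} := fun P =>
  if P is Affine x y then
    y ^+ 2 + a1 * x * y + a3 * y == x ^+ 3 + a2 * x ^+ 2 + a4 * x + a6
  else true.

(* Chord and tangent law on rational points; the slope is the one of the tangent when x1 = x2,
   since then both points coincide unless they are opposite. *)
Definition ec_add (P Q : ec_point K) : ec_point K :=
  match P, Q with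
  | Infinity, _ => Q
  | _, Infinity => P
  | Affine x1 y1, Affine x2 y2 =>
    if (x1 == x2) && (y1 + y2 + a1 * x2 + a3 == 0) then Infinity else
    let l := if x1 == x2 then
               (3%:R * x1 ^+ 2 + 2%:R * a2 * x1 + a4 - a1 * y1)
                 / (2%:R * y1 + a1 * x1 + a3)
             else (y2 - y1) / (x2 - x1) in
    let x3 := l ^+ 2 + a1 * l - a2 - x1 - x2 in
    Affine x3 (l * (x1 - x3) - y1 - a1 * x3 - a3)
  end.

Definition ec_mul (m : nat) (P : ec_point K) : ec_point K :=
  iter m (ec_add P) Infinity.

Definition torsion_point (P : ec_point K) : Prop :=
  exists2 m : nat, (0 < m)%N & ec_mul m P = Infinity.

End GroupLaw.

Definition map_curve (K L : fieldType) (f : K -> L) (E : weierstrass K) :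
    weierstrass L :=
  Weierstrass (f (a1 E)) (f (a2 E)) (f (a3 E)) (f (a4 E)) (f (a6 E)).

Definition map_point (K L : fieldType) (f : K -> L) (P : ec_point K) : ec_point L :=
  if P is Affine x y then Affine (f x) (f y) else Infinity.

(* Main.v *)
Require Import Defs.
From mathcomp Require Import all_boot all_order all_algebra all_field.
From mathcomp Require Import all_classical all_reals all_analysis.
From mathcomp Require Import fingroup cyclic ring lra.
Set Implicit Arguments.
Unset Strict Implicit.
Unset Printing Implicit Defensive.
Import Order.TTheory GRing.Theory Num.Theory.
Local Open Scope ring_scope.

(** The counterexample lives over the rationals: [E : y^2 = x (x^2 - 14 x + 625)],
    [P = (0, 0)] of order 2, and [n = 2], so that [P] has to be divided by 4.

    Write [t = y / x] for an affine point [D = (x, y)] with [x != 0].  The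
    equation of [E] becomes [x + 625 / x = t^2 + 14], and unwinding [4 D = P]
    leaves exactly four possibilities for [t^2], namely 96, -24, -144 and 16.
    They account for all sixteen quarters of [P], and each of these has
    coordinates in [Q(sqrt 6)], [Q(sqrt -6)] or [Q(i)] (for 16 because then
    [x^2 - 30 x + 625 = 0], with roots [15 +- 20 i]).  Every one of the three
    fields does occur ([quarter_of_origin_sqrt]), but none of the sixteen
    points is rational ([no_rational_quarter]).

    The product of -1 and 6 is -6, so one of these three numbers is a square
    modulo any prime [p].  If [p > 3], a Newton iteration lifts the square root
    to the [p]-adic completion ([completion_sqrt]), where [P] therefore has a
    quarter.  What is left is to see that all but finitely many valuations of
    [Q] are [p]-adic for some [p > 3].  This is Ostrowski's theorem, in the
    following form: any two archimedean valuations are equivalent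
    ([arch_unique]), any two ultrametric ones that are smaller than 1 at the
    same prime are equivalent ([nonarch_unique]), and an ultrametric one is
    smaller than 1 at some prime ([nonarch_prime]).  So it suffices to except
    the archimedean class and the classes over 2 and 3.  These classes are
    never constructed: a representative is chosen when there is one. *)

(** * The curve and its 2-torsion point *)

(** This is [y^2 = x (x + a^2) (x + b^2)] for the conjugate numbers
    [a = 3 + 4 i] and [b = 3 - 4 i].  As [a b = 25], the origin is twice the
    rational point [(25, 150)]; as [a = (2 + i)^2] is a square with imaginary
    part a square, the other halves [(-25, _)] of the origin, which are defined
    over [Q(i)], are themselves divisible by 2 over that field. *)
Definition curve (K : fieldType) : weierstrass K :=
  Weierstrass 0 (- 14%:R) 0 625%:R 0.

Lemma map_curveE (K L : fieldType) (f : {rmorphism K -> L}) :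
  map_curve f (curve K) = curve L.
Proof. by rewrite /map_curve /= !rmorph0 rmorphN !rmorph_nat. Qed.

Lemma curve_elliptic (F : realFieldType) : is_elliptic (curve F).
Proof. by rewrite /is_elliptic /discriminant /=; apply/eqP; lra. Qed.

Lemma origin_on_curve (K : fieldType) : Affine 0 0 \in rational_points (curve K).
Proof. by rewrite /rational_points /in_mem /= !mulr0 !addr0 !expr0n !mulr0 !addr0. Qed.

Lemma origin_torsion (K : fieldType) : torsion_point (curve K) (Affine 0 0).
Proof.
by exists 2%N => //; rewrite /ec_mul /= /ec_add eqxx /= !mul0r !addr0 eqxx.
Qed.

(** * Quarters of the origin in quadratic extensions *)

Section Quartering.
Variable K : fieldType.
Implicit Types x y z t r : K.

(** Giving the slope through the equation that it solves makes it possible to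
    supply a polynomial expression for it, so that no division remains. *)
Lemma ec_add_chord (E : weierstrass K) x1 y1 x2 y2 l :
  x2 != x1 -> l * (x2 - x1) = y2 - y1 ->
  ec_add E (Affine x1 y1) (Affine x2 y2) =
    let x3 := l ^+ 2 + a1 E * l - a2 E - x1 - x2 in
    Affine x3 (l * (x1 - x3) - y1 - a1 E * x3 - a3 E).
Proof.
move=> ne12 def_l; rewrite /ec_add eq_sym (negPf ne12) /= -def_l mulfK //.
by rewrite subr_eq0.
Qed.

Lemma ec_add_tangent (E : weierstrass K) x y l :
  let d := 2%:R * y + a1 E * x + a3 E in
  d != 0 -> l * d = 3%:R * x ^+ 2 + 2%:R * a2 E * x + a4 E - a1 E * y ->
  ec_add E (Affine x y) (Affine x y) =
    let x3 := l ^+ 2 + a1 E * l - a2 E - x - x in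
    Affine x3 (l * (x - x3) - y - a1 E * x3 - a3 E).
Proof.
move=> d d0 def_l; rewrite /ec_add eqxx /= -[y + y]mulr2n -[y *+ 2]mulr_natl.
by rewrite -/d (negPf d0) -def_l mulfK.
Qed.

Hypothesis K0 : forall n, n.+1%:R != 0 :> K.

(** The line [y = t x] through the origin meets the curve again in [D = (x, t x)]
    and [(z, t z)], so that [4 D = (0, 0)] amounts to [3 D = (z, t z)].  The double
    of [D] has abscissa [((x^2 - 625) / (2 t x))^2 = ((x - z) / (2 t))^2], which
    is [25 r^2]; the condition [r^4 = 1] says that [2 D] lies over one of the
    abscissas 25 and -25 of the halves of the origin. *)
Lemma quarter_of_origin x z t r : t != 0 -> r ^+ 4 = 1 ->
    x * z = 625%:R -> x + z = t ^+ 2 + 14%:R -> x - z = 10%:R * r * t ->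
  Affine x (t * x) \in rational_points (curve K) /\
  Affine 0 0 = ec_mul (curve K) (2 ^ 2) (Affine x (t * x)).
Proof.
move=> t0 r4 xz xDz xBz.
have r0 : r != 0.
  by apply/eqP => r0; move/eqP: r4; rewrite r0 expr0n eq_sym oner_eq0.
have x0 : x != 0.
  by apply/eqP => x0; move/eqP: xz; rewrite x0 mul0r eq_sym (negPf (K0 624)).
have tr0 : 10%:R * r * t != 0 by rewrite !mulf_neq0 // (K0 9).
have zx : z != x by rewrite -subr_eq0 -oppr_eq0 opprB xBz.
have t2 : t ^+ 2 = x + z - 14%:R by rewrite xDz addrK.
have x2x : 25%:R * r ^+ 2 != x.
  apply/eqP => x2x; move/eqP: zx; apply; apply/(mulfI x0).
  rewrite xz -{1 2}x2x; ring: r4.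
split.
  rewrite /rational_points /in_mem /=; apply/eqP.
  have -> : (t * x) ^+ 2 = t ^+ 2 * x ^+ 2 by ring.
  rewrite t2 -xz; ring.
set D := Affine x (t * x).
have -> : ec_mul (curve K) (2 ^ 2) D =
  ec_add (curve K) D (ec_add (curve K) D (ec_add (curve K) D D)) by [].
have dblD : ec_add (curve K) D D =
    Affine (25%:R * r ^+ 2) ((t + 5%:R * r) * (x - 25%:R * r ^+ 2) - t * x).
  rewrite /D (@ec_add_tangent _ _ _ (t + 5%:R * r)) /=.
  - have -> : (t + 5 * r) ^+ 2 + 0 * (t + 5 * r) - - 14%:R - x - x =
        25%:R * r ^+ 2.
      have -> : (t + 5 * r) ^+ 2 + 0 * (t + 5 * r) - - 14%:R - x - x =
        t ^+ 2 + 10%:R * r * t + 25%:R * r ^+ 2 + 14%:R - x - x by ring.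
      rewrite t2 -xBz; ring.
    by congr Affine; ring.
  - by rewrite mul0r !addr0 !mulf_neq0 // (K0 1).
  - have -> : (t + 5%:R * r) * (2%:R * (t * x) + 0 * x + 0) =
      (2%:R * t ^+ 2 + 10%:R * r * t) * x by ring.
    rewrite t2 -xBz -xz; ring.
have triD : ec_add (curve K) D (ec_add (curve K) D D) = Affine z (t * z).
  have ten0 : 10%:R != 0 :> K := K0 9.
  (* The chord through [D] and [2 D] passes through [- 3 D = (z, - t z)], so
     its slope must be [t (x + z) / (x - z)]. *)
  pose l := (x + z) * r ^+ 3 / 10%:R.
  have tE : t = (x - z) * r ^+ 3 / 10%:R by rewrite xBz; field: r4.
  have l2 : l ^+ 2 = t ^+ 2 + 25%:R * r ^+ 2.
    by rewrite tE /l; field: xz r4.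
  rewrite dblD /D (@ec_add_chord _ _ _ _ _ l) //=; last first.
    by rewrite tE /l; field: xz r4.
  have -> : l ^+ 2 + 0 * l - - 14%:R - x - 25%:R * r ^+ 2 = z.
    rewrite l2 t2; ring.
  by congr Affine; rewrite tE /l; field.
rewrite triD /D (@ec_add_chord _ _ _ _ _ t) //=; last by rewrite mulrBr.
have -> : t ^+ 2 + 0 * t - - 14%:R - x - z = 0 by rewrite t2; ring.
by congr Affine; ring.
Qed.
End Quartering.

(** The three cases are [t^2 = -144], [96] and [-24]; [x] is then a root of
    [x^2 - (t^2 + 14) x + 625]. *)
Lemma quarter_of_origin_sqrt (K : fieldType) (s : K) :
    (forall n, n.+1%:R != 0 :> K) ->
    [\/ s ^+ 2 = - 1, s ^+ 2 = 6%:R | s ^+ 2 = - 6%:R] ->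
  exists D, D \in rational_points (curve K) /\
    Affine 0 0 = ec_mul (curve K) (2 ^ 2) D.
Proof.
move=> K0 s2.
have s0 : s != 0.
  apply/eqP => s0; move: s2; rewrite s0 expr0n /=.
  by case=> /esym/eqP; rewrite ?oppr_eq0 ?oner_eq0 ?(negPf (K0 5)).
case: s2 => s2.
- exists (Affine (- 125%:R) (12%:R * s * - 125%:R)).
  apply: (@quarter_of_origin _ K0 _ (- 5%:R) _ s).
  + by rewrite mulf_neq0 // (K0 11).
  + ring: s2.
  + ring.
  + ring: s2.
  + ring: s2.
- exists (Affine (55%:R + 20%:R * s) (4%:R * s * (55%:R + 20%:R * s))).
  apply: (@quarter_of_origin _ K0 _ (55%:R - 20%:R * s) _ 1).
  + by rewrite mulf_neq0 // (K0 3).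
  + ring.
  + ring: s2.
  + ring: s2.
  + ring.
- exists (Affine (- 5%:R + 10%:R * s) (2%:R * s * (- 5%:R + 10%:R * s))).
  apply: (@quarter_of_origin _ K0 _ (- 5%:R - 10%:R * s) _ 1).
  + by rewrite mulf_neq0 // (K0 1).
  + ring.
  + ring: s2.
  + ring: s2.
  + ring.
Qed.

(** * No quarter of the origin is rational *)

Lemma ec_add_affineP (K : fieldType) (E : weierstrass K) x1 y1 x2 y2 x3 y3 :
    ec_add E (Affine x1 y1) (Affine x2 y2) = Affine x3 y3 ->
  exists l, [/\ x3 = l ^+ 2 + a1 E * l - a2 E - x1 - x2,
    y3 = l * (x1 - x3) - y1 - a1 E * x3 - a3 E &
    if x1 == x2 then
      y1 + y2 + a1 E * x2 + a3 E != 0 /\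
      l = (3%:R * x1 ^+ 2 + 2%:R * a2 E * x1 + a4 E - a1 E * y1)
           / (2%:R * y1 + a1 E * x1 + a3 E)
    else l = (y2 - y1) / (x2 - x1)].
Proof.
rewrite /ec_add; case: eqP => [_|_] /=; last by case=> <- <-; eexists; split.
by case: ifPn => // y12 [<- <-]; eexists; split.
Qed.

Lemma rat_sqr_neq96 (t : rat) : t ^+ 2 != 96%:R.
Proof.
apply/eqP => t2.
have nd : (`|numq t| ^ 2 = 96 * `|denq t| ^ 2)%N.
  apply/eqP; rewrite -(eqr_nat rat) natrM !natrX !natr_absz !intr_norm.
  rewrite !(real_normK (num_real _)).
  have -> : (numq t)%:~R = t * (denq t)%:~R by rewrite -numqE.
  by rewrite exprMn t2.
have d0 : (0 < `|denq t| ^ 2)%N by rewrite expn_gt0 absz_gt0 denq_neq0.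
move: nd => /(congr1 (logn 3)); rewrite (@lognM 3 96 _ isT d0) !lognX => /(congr1 odd).
by rewrite oddD !oddM.
Qed.

(** Over a real field, the only one of the four possible values of [(y / x)^2]
    that survives is 96: two are negative, and 16 leads to an equation for [x]
    with negative discriminant.

    Let [u = t^2], [w = x - 625 / x], and let [l1] and [l2] be the slopes of the
    tangent at [D] and of the chord through [D] and [2 D].  Both slopes have
    simple expressions, [2 t l1 = 2 u + w] and [w l2 = t (u + 14)], and the
    abscissa of [2 D] can be computed from either one; equating gives
    [w = l1^2 - l2^2], which simplifies to [w^4 = (100 u)^2].  Since
    [w^2 = (u + 14)^2 - 50^2], this is an equation of degree 4 for [u]. *)
Lemma real_quarter_slope (F : realFieldType) (x y : F) :
  Affine x y \in rational_points (curve F) ->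
  Affine 0 0 = ec_mul (curve F) (2 ^ 2) (Affine x y) -> (y / x) ^+ 2 = 96%:R.
Proof.
move=> /eqP xyE.
set D := Affine x y.
have -> : ec_mul (curve F) (2 ^ 2) D =
  ec_add (curve F) D (ec_add (curve F) D (ec_add (curve F) D D)) by [].
have {}xyE : y ^+ 2 = x * (x ^+ 2 - 14%:R * x + 625%:R) by move: xyE => /=; lra.
have [x0|x0] := eqVneq x 0.
  have y0 : y = 0.
    by apply/eqP; rewrite -sqrf_eq0 xyE x0 mul0r.
  have DD : ec_add (curve F) D D = Infinity.
    by rewrite /D /ec_add eqxx y0 /= !mul0r !addr0 eqxx.
  (* Here [D] is the origin itself, and [4 D] is the point at infinity. *)
  by rewrite DD -[ec_add _ D Infinity]/D DD.
pose t := y / x; have yE : y = t * x by rewrite /t divfK.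
clearbody t.
have t2 : t ^+ 2 * x = x ^+ 2 - 14%:R * x + 625%:R.
  by apply: (mulfI x0); rewrite -xyE yE; ring.
have t0 : t != 0.
  apply/eqP => t0; move: t2; rewrite t0 expr0n mul0r /=; nra.
have y0 : y != 0 by rewrite yE mulf_neq0.
have [l1 l1E DD] : exists2 l, 2%:R * t * x * l = 3%:R * x ^+ 2 - 28%:R * x + 625%:R
    & ec_add (curve F) D D = Affine (l ^+ 2 + 14%:R - 2%:R * x)
        (l * (3%:R * x - l ^+ 2 - 14%:R) - t * x).
  have d0 : 2%:R * t * x != 0 by rewrite !mulf_neq0.
  pose l := (3%:R * x ^+ 2 - 28%:R * x + 625%:R) / (2%:R * t * x).
  have lE : l * (2%:R * t * x) = 3%:R * x ^+ 2 - 28%:R * x + 625%:R.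
    by rewrite divfK.
  exists l; first by rewrite mulrC.
  rewrite /D yE (ec_add_tangent (l := l)) /=.
  - by congr Affine; ring.
  - by rewrite !mul0r !addr0 mulrA.
  - have -> : l * (2%:R * (t * x) + 0 * x + 0) = l * (2%:R * t * x) by ring.
    by rewrite lE; ring.
(* [D + 3 D] is the origin, so that [3 D] is on the line through [D] and the
   origin. *)
rewrite DD; case tE : (ec_add _ D (Affine _ _)) => [|x3 y3].
  by move=> [x0']; rewrite -x0' eqxx in x0.
move=> /esym/ec_add_affineP[l [/=]].
rewrite mul0r mul0r !subr0 => lx /esym/eqP; rewrite subr_eq0 => /eqP ly.
have {}ly : l = t by apply: (mulIf x0); rewrite -yE.
move: lx; rewrite {}ly => x3E.
have {}x3E : x3 * x = 625%:R.
  have -> : x3 = t ^+ 2 + 14%:R - x by move: x3E; lra.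
  rewrite !mulrDl t2; ring.
have [l2 [x3E2 y3E2 _]] := ec_add_affineP tE.
rewrite /= in x3E2 y3E2.
(* If [D] and [3 D] have the same abscissa then [3 D = - D], against
   [D + 3 D = P]. *)
case: ifPn => [/eqP xx3 [/eqP[]]|xx3 tE3].
  by rewrite y3E2 -xx3; ring.
have x3x : x3 - x != 0 by rewrite subr_eq0 eq_sym.
have y3E : y3 = t * x3.
  by have := divfK x3x (y3 - y); rewrite -tE3 yE; lra.
pose u := t ^+ 2; pose w := x - x3.
have xDx3 : x + x3 = u + 14%:R.
  apply: (mulfI x0); rewrite mulrDr (mulrC x x3) x3E.
  have -> : x * (u + 14%:R) = t ^+ 2 * x + 14%:R * x by rewrite /u; ring.
  by rewrite t2; ring.
have w2 : w ^+ 2 = (u + 14%:R) ^+ 2 - 2500%:R.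
  by rewrite -xDx3 /w; ring: x3E.
have l2w : l2 * w = t * (u + 14%:R).
  by rewrite -xDx3 /w; move: y3E2; rewrite y3E yE; lra.
have l1w : 2%:R * t * l1 = 2%:R * u + w.
  apply: (mulfI x0).
  have -> : x * (2%:R * t * l1) = 2%:R * t * x * l1 by ring.
  have -> : 2%:R * u + w = 2%:R * (x + x3 - 14%:R) + (x - x3) by rewrite xDx3 /w; ring.
  rewrite l1E; ring: x3E.
have wE : w = l1 ^+ 2 - l2 ^+ 2 by rewrite /w; move: x3E2; lra.
have w4 : (w ^+ 2) ^+ 2 = (100%:R * u) ^+ 2.
  have key : w ^+ 2 * (2%:R * u + w) ^+ 2 =
      4%:R * u * w ^+ 3 + 4%:R * u ^+ 2 * (u + 14%:R) ^+ 2.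
    rewrite -l1w -(_ : (t * (u + 14%:R)) ^+ 2 * (4%:R * u) = 4%:R * u ^+ 2 * (u + 14%:R) ^+ 2).
      by rewrite -l2w [w ^+ 3]exprS {2}wE /u; ring.
    by rewrite /u; ring.
  have -> : (w ^+ 2) ^+ 2 = w ^+ 2 * (2%:R * u + w) ^+ 2
      - 4%:R * u * w ^+ 3 - 4%:R * u ^+ 2 * w ^+ 2 by ring.
  by rewrite key w2; ring.
have t2_ge0 : 0 <= u by exact: sqr_ge0.
have : (u - 96%:R) * (u - 16%:R) * ((u + 24%:R) * (u + 144%:R)) = 0.
  have -> : (u - 96%:R) * (u - 16%:R) * ((u + 24%:R) * (u + 144%:R)) =
    ((u + 14%:R) ^+ 2 - 2500%:R) ^+ 2 - (100%:R * u) ^+ 2 by ring.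
  by rewrite -w2 w4 subrr.
have nz (c : F) : 0 < c -> u + c != 0 by move=> c0; rewrite gt_eqF // ltr_wpDl.
move/eqP; rewrite mulf_eq0 (negPf (mulf_neq0 (nz 24%:R _) (nz 144%:R _))) // orbF.
rewrite mulf_eq0 2!subr_eq0 => /orP[/eqP u96|/eqP u16].
  by rewrite yE mulfK.
by move: t2; rewrite -/u u16; nra.
Qed.

Lemma no_rational_quarter (D : ec_point rat) :
  D \in rational_points (curve rat) ->
  Affine 0 0 <> ec_mul (curve rat) (2 ^ 2) D.
Proof.
case: D => [_|x y xyE]; first by [].
by move=> /(real_quarter_slope xyE)/eqP; rewrite (negPf (rat_sqr_neq96 _)).
Qed.

(** * Archimedean and ultrametric valuations *)

(** The device that removes constants from estimates on a multiplicative
    function: apply an estimate to all powers of the argument and take roots.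
    If [x = (1 + h) y] with [h > 0], then [(1 + k h)^2 <= (1 + h)^(2 k)] beats
    every linear function of [k]. *)
Lemma ler_of_exp_growth (R : realType) (x y C D : R) : 0 <= y -> 0 <= C -> 0 <= D ->
  (forall k, x ^+ k <= (C + D * k%:R) * y ^+ k) -> x <= y.
Proof.
move=> y0 C0 D0 xy; rewrite leNgt; apply/negP => yx.
move: y0; rewrite le_eqVlt => /predU1P[y0|y0].
  by have := xy 1%N; rewrite !expr1 -y0 mulr0 leNgt y0 yx.
pose h := x / y - 1.
have h0 : 0 < h by rewrite subr_gt0 ltr_pdivlMr ?mul1r.
have Bern k : 1 + h * k%:R <= (x / y) ^+ k.
  elim: k => [|k IHk]; first by rewrite mulr0 addr0.
  rewrite exprS (_ : x / y = 1 + h); last by rewrite /h addrC subrK.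
  rewrite (_ : x / y = 1 + h) in IHk; last by rewrite /h addrC subrK.
  apply: le_trans (ler_wpM2l _ IHk); last by rewrite addr_ge0 // ltW.
  have kh : 0 <= h * h * k%:R by rewrite !mulr_ge0 // ltW.
  by rewrite -natr1; lra.
have bnd k : (1 + h * k%:R) ^+ 2 <= C + 2%:R * D * k%:R.
  have := xy (k * 2)%N; rewrite natrM => xyk.
  apply: (@le_trans _ _ ((x / y) ^+ (k * 2))).
    rewrite exprM lerXn2r ?nnegrE //.
    - by rewrite addr_ge0 // mulr_ge0 // ltW.
    - by rewrite exprn_ge0 // divr_ge0 // ltW // (lt_trans y0).
  rewrite expr_div_n ler_pdivrMr ?exprn_gt0 //.
  by apply: le_trans xyk _; rewrite (mulrC 2%:R) mulrAC -mulrA.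
pose k := Num.Def.archi_bound ((C + 2%:R * D) / h ^+ 2).
have h2 : 0 < h ^+ 2 by rewrite exprn_gt0.
have kP : C + 2%:R * D < h ^+ 2 * k%:R.
  rewrite [ltRHS]mulrC -ltr_pdivrMr //; apply: archi_boundP.
  by apply: divr_ge0; [rewrite addr_ge0 // mulr_ge0|exact: ltW].
have k1 : 1 <= k%:R :> R.
  rewrite ler1n lt0n; apply/eqP => k0; move: kP; rewrite k0 mulr0.
  by rewrite ltNge addr_ge0 // mulr_ge0.
have := bnd k; rewrite leNgt => /negP; apply.
have : C * 1 <= C * k%:R by rewrite ler_wpM2l.
have : (C + 2%:R * D) * k%:R < h ^+ 2 * k%:R * k%:R.
  by rewrite ltr_pM2r // (lt_le_trans _ k1).
have : 0 <= h * k%:R by rewrite mulr_ge0 // ltW.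
by nra.
Qed.

Section Valuations.
Variables (R : realType) (k : fieldType).
Implicit Types v w : valuation R k.

(** Boundedness on the natural numbers, unlike the ultrametric inequality to
    which it is equivalent ([nonarch_ultrametric]), has a negation that
    Ostrowski's argument can start from. *)
Definition nonarch v := forall n : nat, v n%:R <= 1.

Lemma vabsX v x n : v (x ^+ n) = v x ^+ n.
Proof. by elim: n => [|n IHn]; rewrite ?expr0 ?vabs1 // !exprS vabsM IHn. Qed.

Lemma vabs_natr_le v n : v n%:R <= n%:R.
Proof.
elim: n => [|n IHn]; first by rewrite vabs0.
by rewrite -!natr1 (le_trans (vabsD _ _ _)) // vabs1 lerD2r.
Qed.

Lemma vabs_sum v (I : Type) (r : seq I) (P : pred I) (F : I -> k) :
  v (\sum_(i <- r | P i) F i) <= \sum_(i <- r | P i) v (F i).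
Proof.
elim/big_rec2: _ => [|i y z _ yz]; first by rewrite vabs0.
by rewrite (le_trans (vabsD _ _ _)) // lerD2l.
Qed.

Lemma vabs_intr v (z : int) : v z%:~R = v `|z|%N%:R.
Proof. by case: z => n //; rewrite NegzE rmorphN vabsN. Qed.

Lemma nonarch_intr v (z : int) : nonarch v -> v z%:~R <= 1.
Proof. by rewrite vabs_intr. Qed.

(** Binomial coefficients have absolute value at most 1, so the binomial
    formula bounds [v (x + y) ^+ n] by [n + 1] times [max (v x) (v y) ^+ n]. *)
Lemma nonarch_ultrametric v x y :
  nonarch v -> v (x + y) <= Num.max (v x) (v y).
Proof.
move=> na; set M := Num.max _ _.
have M0 : 0 <= M by rewrite le_max vabs_ge0.
apply: (@ler_of_exp_growth _ _ _ 1 1) => // n.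
rewrite -vabsX exprDn (le_trans (vabs_sum _ _ _ _)) //.
rewrite (le_trans (_ : _ <= \sum_(i < n.+1) M ^+ n)) //; last first.
  by rewrite sumr_const card_ord -[leLHS]mulr_natl -natr1 mul1r addrC.
apply: ler_sum => i _; rewrite -[X in v X]mulr_natl vabsM -[leRHS]mul1r.
rewrite ler_pM ?vabs_ge0 // vabsM !vabsX.
rewrite -[in leRHS](@subnK i n) ?exprD; last by rewrite -ltnS.
by rewrite ler_pM ?exprn_ge0 ?vabs_ge0 // lerXn2r ?nnegrE ?vabs_ge0 // /M le_max lexx ?orbT.
Qed.

Lemma nonarch_vabsD_lt v x y e :
  nonarch v -> v x < e -> v y < e -> v (x + y) < e.
Proof.
move=> na xe ye; apply: le_lt_trans (nonarch_ultrametric _ _ na) _.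
by rewrite gt_max xe.
Qed.

(** Expand [m ^ i] in base [n]: it has about [i ln m / ln n] digits, each of
    absolute value at most [n]. *)
Lemma vabs_natr_le_powR v (n m : nat) : (1 < n)%N -> (0 < m)%N ->
  v m%:R <= Num.max 1 (v n%:R) `^ (ln m%:R / ln n%:R).
Proof.
move=> n1 m0; set M := Num.max _ _.
have M1 : 1 <= M by rewrite le_max lexx.
have M0 : 0 < M := lt_le_trans ltr01 M1.
have digits j : forall i, (i < n ^ j)%N -> v i%:R <= n%:R * j%:R * M ^+ j.
  elim: j => [|j IHj] i; first by rewrite expn0 ltnS leqn0 => /eqP->; rewrite vabs0 mulr0 mul0r.
  move=> ij; rewrite (divn_eq i n) natrD natrM.
  apply: le_trans (vabsD _ _ _) _.
  have qj : (i %/ n < n ^ j)%N by rewrite ltn_divLR ?(ltnW n1) // -expnSr.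
  have rn : v (i %% n)%:R <= n%:R.
    by apply: le_trans (vabs_natr_le _ _) _; rewrite ler_nat ltnW // ltn_pmod // ltnW.
  have Mj : 1 <= M ^+ j.+1 by rewrite exprn_ege1.
  have -> : n%:R * j.+1%:R * M ^+ j.+1 = n%:R * j%:R * M ^+ j * M + n%:R * M ^+ j.+1.
    by rewrite -natr1 exprS; ring.
  rewrite lerD //.
    by rewrite vabsM ler_pM ?vabs_ge0 ?IHj // /M le_max lexx orbT.
  by rewrite (le_trans rn) // ler_peMr.
have lnn : 0 < ln (n%:R : R) by rewrite ln_gt0 // ltr1n.
have lnm : 0 <= ln (m%:R : R) by rewrite ln_ge0 // ler1n.
set L := _ / _; have L0 : 0 <= L by rewrite divr_ge0 // ltW.
apply: (@ler_of_exp_growth _ _ _ (n%:R * M) (n%:R * L * M)).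
- exact: powR_ge0.
- by apply: mulr_ge0 => //; exact: ltW.
- by apply: mulr_ge0; [exact: mulr_ge0|exact: ltW].
move=> i; pose j := (Num.trunc (L * i%:R)).+1.
have Li0 : 0 <= L * i%:R by rewrite mulr_ge0.
have /andP[jle jgt] := truncn_itv Li0.
have mj : (m ^ i < n ^ j)%N.
  rewrite -(ltr_nat R) -ltr_ln ?posrE ?ltr0n ?expn_gt0 ?m0 ?(ltnW n1) //.
  rewrite !natrX !lnXn ?ltr0n // ?(ltnW n1) //.
  rewrite -[ltLHS]mulr_natr -[ltRHS]mulr_natl -ltr_pdivrMr // mulrAC.
  exact: jgt.
have := digits j _ mj; rewrite natrX vabsX => /le_trans; apply.
have -> : (n%:R * M + n%:R * L * M * i%:R) * (M `^ L) ^+ i =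
    n%:R * (L * i%:R + 1) * (M * (M `^ L) ^+ i) by ring.
rewrite -[leLHS]mulrA -[leRHS]mulrA; apply: ler_wpM2l => //.
apply: ler_pM; [by []|by rewrite exprn_ge0 // ltW| |].
  by rewrite /j -natr1 lerD2r.
rewrite -powR_mulrn ?powR_ge0 // -powRrM -powR_mulrn ?(ltW M0) //.
rewrite -{2}(powRr1 (ltW M0)) -powRD ?(gt_eqF M0) ?implybT //.
by rewrite ler_powR // /j -natr1 addrC lerD2l.
Qed.

(** By the previous bound, [ln (v n) / ln n] does not depend on [n > 1]. *)
Lemma arch_vabs_natr v : ~ nonarch v ->
  exists2 c : R, 0 < c & forall n : nat, v n%:R = n%:R `^ c.
Proof.
move=> /existsNP[m0 /negP]; rewrite -ltNge => vm0.
have m0_gt0 : (0 < m0)%N.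
  by rewrite lt0n; apply: contraTneq vm0 => ->; rewrite vabs0 -leNgt.
have vn_gt1 n : (1 < n)%N -> 1 < v n%:R.
  move=> n1; rewrite ltNge; apply/negP => vn1.
  have := vabs_natr_le_powR v n1 m0_gt0; rewrite (max_idPl vn1) powR1.
  by rewrite leNgt vm0.
have lnn n : (1 < n)%N -> 0 < ln (n%:R : R) by move=> n1; rewrite ln_gt0 // ltr1n.
have slope n m : (1 < n)%N -> (1 < m)%N ->
    ln (v m%:R) / ln m%:R <= ln (v n%:R) / ln n%:R.
  move=> n1 m1; have := vabs_natr_le_powR v n1 (ltnW m1).
  have vn := vn_gt1 _ n1; have vm := vn_gt1 _ m1.
  rewrite (max_idPr (ltW vn)) -ler_ln ?posrE ?powR_gt0 ?(lt_trans ltr01) //.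
  rewrite ln_powR => mn.
  by rewrite ler_pdivrMr ?lnn // mulrAC [_ * ln m%:R]mulrC mulrAC.
exists (ln (v 2%:R) / ln 2%:R).
  by rewrite divr_gt0 ?lnn // ln_gt0 // vn_gt1.
case=> [|[|n]].
- by rewrite vabs0 powR0 // gt_eqF // divr_gt0 ?lnn // ln_gt0 // vn_gt1.
- by rewrite vabs1 powR1.
have -> : ln (v 2%:R) / ln 2%:R = ln (v n.+2%:R) / ln n.+2%:R.
  by apply/le_anti; rewrite !slope.
by rewrite /powR gt_eqF ?ltr0n // divfK ?lnK ?gt_eqF ?lnn // posrE (lt_trans ltr01) ?vn_gt1.
Qed.

(** If [v] were smaller than 1 at both [p] and [n], it would be so at 1 by a
    Bezout relation. *)
Lemma nonarch_coprime_vabs v (p n : nat) :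
  nonarch v -> (0 < p)%N -> v p%:R < 1 -> coprime p n -> v n%:R = 1.
Proof.
move=> na p0 vp /(coprimeP _ p0)[[a b] /= ab].
apply/eqP; rewrite eq_le na leNgt; apply/negP => vn.
have lt1 m c : v m%:R < 1 -> v (c%:R * m%:R) < 1.
  by move=> vm; rewrite vabsM (le_lt_trans _ vm) // ler_piMl ?vabs_ge0.
have : v (a%:R * p%:R - b%:R * n%:R) < 1.
  by rewrite nonarch_vabsD_lt ?vabsN ?lt1.
rewrite -!natrM -natrB; last by rewrite leqNgt; apply/negP => /ltnW; rewrite /leq ab.
by rewrite ab vabs1 ltxx.
Qed.

End Valuations.

(** * The valuations of the field of rational numbers *)

Section RationalValuations.
Variable R : realType.
Implicit Types v w : valuation R rat.

Lemma vabs_rat v (x : rat) : v x = v `|numq x|%N%:R / v `|denq x|%N%:R.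
Proof. by rewrite -[in LHS](divq_num_den x) vabsM vabsV !vabs_intr. Qed.

Lemma veq_natr v w (s : R) : 0 < s ->
  (forall n : nat, w n%:R = v n%:R `^ s) -> veq v w.
Proof.
move=> s0 vw; exists s => // x.
rewrite (vabs_rat v x) (vabs_rat w x) !vw powRM ?invr_ge0 ?vabs_ge0 //; congr (_ * _).
by rewrite -[in RHS](powR_inv1 (vabs_ge0 v _)) -powRrM mulN1r powRN.
Qed.

Lemma arch_unique v w : ~ nonarch v -> ~ nonarch w -> veq v w.
Proof.
move=> /arch_vabs_natr[c c0 vE] /arch_vabs_natr[d d0 wE].
apply: (@veq_natr _ _ (d / c)); first exact: divr_gt0.
by move=> n; rewrite wE vE -powRrM mulrC divfK // gt_eqF.
Qed.

Lemma nonarch_vabs_natr v (p n : nat) : nonarch v -> prime p -> v p%:R < 1 ->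
  (0 < n)%N -> v n%:R = v p%:R ^+ logn p n.
Proof.
move=> na p_pr vp n0; have [m co {1}->] := pfactor_coprime p_pr n0.
rewrite natrM vabsM natrX vabsX.
by rewrite (nonarch_coprime_vabs na (prime_gt0 p_pr)) ?mul1r.
Qed.

Lemma nonarch_unique (p : nat) (p_pr : prime p) v w :
  nonarch v /\ v p%:R < 1 -> nonarch w /\ w p%:R < 1 -> veq v w.
Proof.
move=> [nav vp] [naw wp].
have p_neq0 : p%:R != 0 :> rat by rewrite pnatr_eq0 -lt0n prime_gt0.
have vp0 : 0 < v p%:R by rewrite lt0r vabs_eq0 p_neq0 vabs_ge0.
have wp0 : 0 < w p%:R by rewrite lt0r vabs_eq0 p_neq0 vabs_ge0.
have lnv : ln (v p%:R) < 0 by rewrite ln_lt0 ?vp0 ?vp.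
have s0 : 0 < ln (w p%:R) / ln (v p%:R).
  by rewrite nmulr_rgt0 ?invr_lt0 // ln_lt0 ?wp0.
apply: (veq_natr s0) => -[|n]; first by rewrite !vabs0 powR0 // gt_eqF.
rewrite (nonarch_vabs_natr (n := n.+1) nav p_pr) // (nonarch_vabs_natr (n := n.+1) naw p_pr) //.
rewrite -[X in _ = X `^ _]powR_mulrn ?vabs_ge0 // -powRrM mulrC.
rewrite powRrM powR_mulrn ?powR_ge0 //; congr (_ ^+ _).
by rewrite /powR gt_eqF // divfK ?lt_eqF // lnK.
Qed.

Lemma nonarch_prime v : nonarch v -> exists2 p, prime p & v p%:R < 1.
Proof.
move=> na; have [x x0 vx] := vabs_nontrivial v.
have exn : exists n : nat, (0 < n)%N && (v n%:R < 1).
  apply: contrapT => no; move/eqP: vx; apply.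
  have v1 (n : nat) : (0 < n)%N -> v n%:R = 1.
    move=> n0; apply/eqP; rewrite eq_le na leNgt; apply/negP => vn.
    by apply: no; exists n; rewrite n0.
  by rewrite vabs_rat !v1 ?divr1 // absz_gt0 ?denq_neq0 ?numq_eq0.
case: (ex_minnP exn) => n /andP[n0 vn] nmin.
have n1 : (1 < n)%N.
  by rewrite ltn_neqAle n0 andbT; apply: contraTneq vn => <-; rewrite vabs1 ltxx.
exists (pdiv n); first exact: pdiv_prime.
rewrite ltNge; apply/negP => vp.
have p1 : (1 < pdiv n)%N by rewrite prime_gt1 // pdiv_prime.
have q0 : (0 < n %/ pdiv n)%N by rewrite divn_gt0 ?pdiv_leq // pdiv_gt0.
suff vq : v (n %/ pdiv n)%N%:R < 1.
  by have := nmin (n %/ pdiv n)%N; rewrite q0 vq leqNgt ltn_Pdiv // => /(_ isT).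
apply: le_lt_trans vn; rewrite -[in leRHS](divnK (pdiv_dvd n)) natrM vabsM.
by rewrite ler_peMr ?vabs_ge0.
Qed.

End RationalValuations.

(** * Square roots in completions *)

(** In a cyclic group, the product of two odd powers of a generator is an even
    power. *)
Lemma finField_sqr_or_mul (F : finFieldType) (a b : F) :
  exists z : F, [\/ z ^+ 2 = a, z ^+ 2 = b | z ^+ 2 = a * b].
Proof.
have [->|a0] := eqVneq a 0; first by exists 0; constructor 1; rewrite expr0n.
have [->|b0] := eqVneq b 0; first by exists 0; constructor 2; rewrite expr0n.
have /cyclicP[g gE] := field_unit_group_cyclic [set: {unit F}]%G.
have pow c : c != 0 -> exists i, c = FinRing.uval g ^+ i.
  rewrite -unitfE => Uc; have : FinRing.Unit Uc \in [set: {unit F}]%g by rewrite inE.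
  rewrite gE => /cycleP[i ci]; exists i.
  by rewrite -FinRing.val_unitX -ci.
have [[i ai] [j bj]] := (pow _ a0, pow _ b0).
have even m : ~~ odd m -> exists z, z ^+ 2 = FinRing.uval g ^+ m.
  move=> em; exists (FinRing.uval g ^+ m./2); rewrite -exprM muln2.
  by rewrite -[in RHS](odd_double_half m) (negPf em).
case oi: (odd i); last first.
  by have [|z zE] := even i; [rewrite oi|exists z; constructor 1; rewrite zE].
case oj: (odd j); last first.
  by have [|z zE] := even j; [rewrite oj|exists z; constructor 2; rewrite zE].
have [|z zE] := even (i + j)%N; first by rewrite oddD oi oj.
by exists z; constructor 3; rewrite zE exprD -ai -bj.
Qed.

Section Hensel.
Variables (R : realType) (k : fieldType) (v : valuation R k).

(** Newton's iteration for [x^2 - a] squares the error [x^2 - a] at each step,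
    up to the factor [4 x^2], which is a unit.  The geometric bound [d ^+ n.+1] on
    the error after [n] steps, much weaker than [d ^+ (2 ^ n)], is enough for
    convergence. *)
Lemma completion_sqrt (a x0 : k) : nonarch v ->
    v 2%:R = 1 -> v x0 = 1 -> v (x0 ^+ 2 - a) < 1 ->
  exists s : completion v, s ^+ 2 = to_completion v a.
Proof.
move=> na v2 vx0 d1; set d := v _ in d1.
have d0 : 0 <= d := vabs_ge0 _ _.
pose step x := x - (x ^+ 2 - a) / (2%:R * x).
pose x n := iter n step x0.
have k2 : 2%:R != 0 :> k by rewrite -(vabs_eq0 v) v2 oner_eq0.
have xP n : v (x n) = 1 /\ v (x n ^+ 2 - a) <= d ^+ n.+1.
  elim: n => [|n [vx dx]]; first by rewrite expr1.
  have xn0 : x n != 0 by rewrite -(vabs_eq0 v) vx oner_eq0.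
  have dn1 : d ^+ n.+1 < 1 by rewrite exprn_ilt1.
  have v2x : v (2%:R * x n) = 1 by rewrite vabsM v2 vx mulr1.
  split; last first.
    have -> : x n.+1 ^+ 2 - a = ((x n ^+ 2 - a) / (2%:R * x n)) ^+ 2.
      by rewrite /= -/(x n) /step; field; rewrite k2 xn0.
    rewrite vabsX vabsM vabsV v2x invr1 mulr1 expr2.
    rewrite exprSr ler_pM ?vabs_ge0 // (le_trans dx) //.
    by rewrite exprSr ler_piMl // exprn_ile1 // ltW.
  have vstep : v ((x n ^+ 2 - a) / (2%:R * x n)) < 1.
    by rewrite vabsM vabsV v2x invr1 mulr1 (le_lt_trans dx).
  apply/eqP; rewrite eq_le; apply/andP; split.
    rewrite /= -/(x n) /step (le_trans (nonarch_ultrametric _ _ na)) //.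
    by rewrite ge_max vx lexx vabsN ltW.
  rewrite leNgt; apply/negP => xlt.
  have := nonarch_vabsD_lt na xlt vstep.
  by rewrite /= -/(x n) /step subrK vx ltxx.
have stepP n : v (x n.+1 - x n) <= d ^+ n.+1.
  have [vx dx] := xP n.
  rewrite /= -/(x n) /step addrAC subrr sub0r vabsN vabsM vabsV vabsM v2 vx.
  by rewrite mulr1 invr1 mulr1.
have tail n j : v (x (n + j)%N - x n) <= d ^+ n.+1.
  elim: j => [|j IHj]; first by rewrite addn0 subrr vabs0 exprn_ge0.
  rewrite addnS -(subrK (x (n + j)%N) (x _.+1)) -addrA.
  rewrite (le_trans (nonarch_ultrametric _ _ na)) // ge_max IHj andbT.
  apply: le_trans (stepP _) _.
  by rewrite (ler_wiXn2l d0 (ltW d1)) // ltnS leq_addr.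
have d1' : `|d| < 1 by rewrite ger0_norm.
have small (e : R) : 0 < e -> exists N, d ^+ N.+1 < e.
  move=> e0; have /cvgrPdist_lt/(_ _ e0)[N _ /(_ N (leqnn N))] := cvg_expr d1'.
  rewrite /= sub0r normrN ger0_norm ?exprn_ge0 // => Ne; exists N.
  by apply: le_lt_trans Ne; rewrite (ler_wiXn2l d0 (ltW d1)).
have cx : is_cauchy v x.
  move=> e /small[N Ne]; exists N => m n Nm Nn.
  have -> : x m - x n = (x m - x N) + (x N - x n) by ring.
  apply: nonarch_vabsD_lt => //.
    by rewrite -(subnKC Nm) (le_lt_trans (tail _ _)).
  by rewrite -vabsN opprB -(subnKC Nn) (le_lt_trans (tail _ _)).
exists (class_of (CauchySeq (asboolT cx))).
rewrite /to_completion expr2 -rmorphM eq_class_of => e /small[N Ne].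
exists N => n Nn; rewrite -[cseq _ n - _]/(x n * x n - a) -expr2.
apply: le_lt_trans Ne; apply: le_trans (xP n).2 _.
by rewrite (ler_wiXn2l d0 (ltW d1)).
Qed.
End Hensel.

(** * Properties of almost all valuations *)

Section AlmostAll.
Variables (R : realType) (k : fieldType).
Implicit Types (Q : valuation R k -> Prop) (v w : valuation R k).

Lemma almost_all_and Q1 Q2 : for_almost_all_valuations Q1 ->
  for_almost_all_valuations Q2 ->
  for_almost_all_valuations (fun v => Q1 v /\ Q2 v).
Proof.
move=> [N1 [w1 Qw1]] [N2 [w2 Qw2]]; exists (N1 + N2)%N.
exists (fun i => match fintype.split i with inl j => w1 j | inr j => w2 j end) => v vP.
split; [apply: Qw1 => i | apply: Qw2 => i].
- by have := vP (unsplit (inl i)); rewrite unsplitK.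
- by have := vP (unsplit (inr i)); rewrite unsplitK.
Qed.

Lemma almost_all_impl Q1 Q2 : (forall v, Q1 v -> Q2 v) ->
  for_almost_all_valuations Q1 -> for_almost_all_valuations Q2.
Proof. by move=> Q12 [N [w Qw]]; exists N, w => v /Qw/Q12. Qed.

Lemma almost_all_not Q : (forall v w, Q v -> Q w -> veq v w) ->
  for_almost_all_valuations (fun v => ~ Q v).
Proof.
move=> Quniq; have [[w Qw]|noQ] := pselect (exists w, Q w).
  by exists 1%N, (fun=> w) => v vw Qv; apply: (vw ord0); exact: Quniq.
by exists 0%N, (fun i : 'I_0 => False_rect _ (notF (ltn_ord i))) => v _ Qv; apply: noQ; exists v.
Qed.
End AlmostAll.

(** * One of -1, 6, -6 is a square in almost all completions *)

Section LocalSquares.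
Variable R : realType.
Implicit Type v : valuation R rat.

Lemma sqr_mod_vabs_lt1 v (p : nat) (z : 'F_p) (a : int) :
    nonarch v -> prime p -> v p%:R < 1 -> z ^+ 2 = a%:~R ->
  v (((z : nat)%:R : rat) ^+ 2 - a%:~R) < 1.
Proof.
move=> na p_pr vp z2.
have /dvdzP[q qE] : (p %| ((z : nat)%:Z ^+ 2 - a)%R)%Z.
  by rewrite (dvdz_pcharf (pchar_Fp p_pr)) rmorphB rmorphXn /= -pmulrn natr_Zp z2 subrr.
have -> : ((z : nat)%:R : rat) ^+ 2 - a%:~R = q%:~R * p%:R.
  by rewrite pmulrn -rmorphXn -rmorphB /= qE rmorphM.
by rewrite vabsM (le_lt_trans _ vp) // ler_piMl ?vabs_ge0 ?nonarch_intr.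
Qed.

Lemma intr_completion_sqrt v (p : nat) (z : 'F_p) (a : int) :
    nonarch v -> v 2%:R = 1 -> prime p -> v p%:R < 1 -> v a%:~R = 1 ->
    z ^+ 2 = a%:~R ->
  exists s : completion v, s ^+ 2 = a%:~R.
Proof.
move=> na v2 p_pr vp va z2.
have vz := sqr_mod_vabs_lt1 na p_pr vp z2.
have [|s sE] := completion_sqrt na v2 _ vz.
  apply/eqP; rewrite eq_le na leNgt; apply/negP => vz1.
  suff : v a%:~R < 1 by rewrite va ltxx.
  have -> : a%:~R = (z : nat)%:R ^+ 2 - ((z : nat)%:R ^+ 2 - a%:~R) :> rat.
    by rewrite opprB addrC subrK.
  by rewrite nonarch_vabsD_lt ?vabsN // vabsX exprn_ilt1 ?vabs_ge0.
by exists s; rewrite sE rmorph_int.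
Qed.

Lemma almost_all_sqrt : for_almost_all_valuations (fun v =>
  exists s : completion v, [\/ s ^+ 2 = - 1, s ^+ 2 = 6%:R | s ^+ 2 = - 6%:R]).
Proof.
have arch := almost_all_not (@arch_unique R).
have over2 := almost_all_not (@nonarch_unique R 2 isT).
have over3 := almost_all_not (@nonarch_unique R 3 isT).
apply: almost_all_impl (almost_all_and arch (almost_all_and over2 over3)).
move=> v [/contrapT na [n2 n3]].
have [p p_pr vp] := nonarch_prime na.
have p0 := prime_gt0 p_pr.
have vq q : prime q -> ~ (nonarch v /\ v q%:R < 1) -> v q%:R = 1.
  move=> q_pr nq; apply: (nonarch_coprime_vabs na p0 vp).
  rewrite prime_coprime // dvdn_prime2 //.
  by apply/eqP => pq; apply: nq; rewrite -pq.
have v2 : v 2%:R = 1 := vq 2%N isT n2.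
have v6 : v 6%:R = 1 by rewrite (natrM _ 2 3) vabsM v2 (vq 3%N isT n3) mulr1.
have [z zP] := finField_sqr_or_mul (- 1 : 'F_p) 6%:R.
have sqrt a : v a%:~R = 1 -> z ^+ 2 = a%:~R ->
    exists s : completion v, s ^+ 2 = a%:~R := intr_completion_sqrt na v2 p_pr vp.
case: zP => z2.
- by have [||s] := sqrt (- 1); rewrite ?rmorphN ?vabsN ?vabs1 //; exists s; constructor 1.
- by have [||s] := sqrt 6%:Z; rewrite -?pmulrn //; exists s; constructor 2.
- have [||s] := sqrt (- 6%:Z); rewrite ?rmorphN ?vabsN -?pmulrn //.
    by rewrite z2 mulN1r.
  by exists s; constructor 3.
Qed.
End LocalSquares.

(** * The counterexample *)

Theorem proposition13 (R : realType) :
  exists (k : fieldExtType rat) (E : weierstrass k) (n : nat) (P : ec_point k),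
    [/\ is_elliptic E, (1 <= n)%N, P \in rational_points E & torsion_point E P] /\
    for_almost_all_valuations (fun v : valuation R k =>
      let Ev := map_curve (to_completion v) E in
      exists Dv : ec_point (completion v),
        Dv \in rational_points Ev /\
        map_point (to_completion v) P = ec_mul Ev (2 ^ n) Dv) /\
    ~ (exists D : ec_point k,
        D \in rational_points E /\ P = ec_mul E (2 ^ n) D).
Proof.
exists rat^o, (curve rat), 2%N, (Affine 0 0); split; last split.
- split.
  + exact: curve_elliptic.
  + by [].
  + exact: origin_on_curve.
  + exact: origin_torsion.
- apply: almost_all_impl (almost_all_sqrt R) => v [s sP].
  have K0 n : n.+1%:R != 0 :> completion v.
    by rewrite -(rmorph_nat (to_completion v)) fmorph_eq0 pnatr_eq0.
  have [D [ED DP]] := quarter_of_origin_sqrt K0 sP.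
  exists D; rewrite (map_curveE (to_completion v)); split => //.
  by rewrite -DP /= rmorph0.
- by move=> [D [ED /(no_rational_quarter ED)]].
Qed.
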